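(* Let $W$ be a nondeterministic recursive probabilistic program (given by its control-flow graph) with a sampling function $\Upsilon$. For every difference-bounded ranking measure function $h$ for $W$ with corresponding constants $\epsilon$ (ranking) and $\zeta$ (difference bound), it holds that for all $n\in\mathbb N_0$ and all non-terminal stack elements $\mathfrak c$ such that $h(\mathfrak c)<\infty$ and $n>\frac{h(\mathfrak c)}{\epsilon}$, $$\sup_\sigma\mathbb P^\sigma_{\mathfrak c}(T>n)\le e^{-\frac{(\epsilon\cdot n-h(\mathfrak c))^2}{2\cdot n\cdot(\epsilon+\zeta)^2}},$$ where $\sigma$ ranges over all schedulers for $W$.
   Context: **Programs.** For a finite set $V$ of variables, $\mathrm{Val}_V$ is the set of functions (valuations) $V\to\mathbb Z$. A nondeterministic recursive probabilistic program $W$ is represented by its control-flow graph: a finite set $F$ of function names, a finite set $V_r$ of sampling variables and, for each $f\in F$: a finite set $V^f$ of program variables (write $\mathrm{Val}_f:=\mathrm{Val}_{V^f}$); a finite set $L^f$ of labels partitioned into branching labels $L_b^f$, assignment labels $L_a^f$, call labels $L_c^f$ and nondeterministic labels $L_d^f$; an initial label $\ell_{in}^f\in L^f$ and a terminal label $\ell_{out}^f\in L^f$ with $\ell_{in}^f\ne\ell_{out}^f$; and a set $\to_f$ of triples (source label, decoration, target label). For each $\ell\in L^f\setminus\{\ell_{out}^f\}$ the triples with source $\ell$ are: - if $\ell\in L_a^f$: exactly one triple $(\ell,u,\ell')$ with update function $u:\mathrm{Val}_f\times\mathrm{Val}_{V_r}\to\mathrm{Val}_f$; - if $\ell\in L_c^f$: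 exactly one triple $(\ell,(g,v),\ell')$ with $g\in F$ and value-passing function $v:\mathrm{Val}_f\to\mathrm{Val}_g$; - if $\ell\in L_b^f$: exactly two triples $(\ell,\phi,\ell_1),(\ell,\neg\phi,\ell_2)$ with $\phi$ a propositional arithmetic predicate over $V^f$ (Boolean combination of comparisons of integer-valued arithmetic expressions); - if $\ell\in L_d^f$: exactly two triples $(\ell,\star,\ell_1),(\ell,\star,\ell_2)$ (the then-branch and the else-branch, respectively). **Sampling.** A sampling function $\Upsilon$ assigns to each $r\in V_r$ a discrete probability distribution on $\mathbb Z$; $\overline\Upsilon(\mu):=\prod_{r\in V_r}\Upsilon(r)(\mu(r))$ for $\mu\in\mathrm{Val}_{V_r}$, and $\mathrm{Val}^r:=\{\mu:\overline\Upsilon(\mu)>0\}$. **Semantics.** A stack element is a triple $(f,\ell,\nu)$ with $f\in F$, $\ell\in L^f$, $\nu\in\mathrm{Val}_f$; it is terminal if $\ell=\ell_{out}^f$. $\mathcal E$ is the set of stack elements. A configuration is a finite word (possibly the empty word $\varepsilon$) of non-terminal stack elements, the first letter being the top of the stack. For a stack element $\mathfrak d$ let $[\mathfrak d]$ be the one-letter word $\mathfrak d$ if $\mathfrak d$ is non-terminal and $\varepsilon$ otherwise. States are pairs $(w,\mu)$ of a configuration and $\mu\in\mathrm{Val}_{V_r}$. In one step from $((f,\ell,\nu)\cdot w,\mu)$, $\mu'$ is drawn with probability $\overline\Upsilon(\mu')$ and the next state is $(w',\mu')$ where - assignment: $w'=[(f,\ell',u(\nu,\mu'))]\cdot w$;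 - call: $w'=(g,\ell_{in}^g,v(\nu))\cdot[(f,\ell',\nu)]\cdot w$; - branching: $w'=[(f,\ell_1,\nu)]\cdot w$ if $\nu\models\phi$, and $w'=[(f,\ell_2,\nu)]\cdot w$ otherwise; - nondeterministic: $w'=[(f,\ell_1,\nu)]\cdot w$ under action $\mathbf{th}$ and $w'=[(f,\ell_2,\nu)]\cdot w$ under action $\mathbf{el}$. From $(\varepsilon,\mu)$ the next state is $(\varepsilon,\mu')$ with probability $\overline\Upsilon(\mu')$. In non-nondeterministic states there is effectively a single action $\tau$; when the top label is nondeterministic the enabled actions are $\mathbf{th},\mathbf{el}$. A history is a finite nonempty sequence of states in which each consecutive pair has positive transition probability under some action. A scheduler $\sigma$ maps every history to a probability distribution over the actions enabled at its last state. For a scheduler $\sigma$ and a non-terminal stack element $\mathfrak c$, $\mathbb P^\sigma_{\mathfrak c}$ is the induced probability measure on infinite sequences of states starting in $(\mathfrak c,\mathbf 0)$, where $\mathbf 0$ is the zero valuation. **Termination time.** $T(\{(w_n,\mu_n)\}_{n\ge0}):=\min\{n\ge 0: w_n=\varepsilon\}$ ($\min\emptyset=\infty$). **Ranking measure functions.** A ranking measure function for $W$ with corresponding constant $\epsilon\in(0,\infty)$ is a function $h:\mathcal E\to[0,\infty]$ such that for all stack elements $(f,\ell,\nu)$: - (C1) if $\ell=\ell_{out}^f$ then $h(f,\ell,\nu)=0$; - (C2) if $\ell\in L_a^f\setminus\{\ell_{out}^f\}$ and $(\ell,u,\ell')$ is the only triple in $\to_f$ with source $\ell$: $\epsilon+\sum_{\mu\in\mathrm{Val}^r}\overline\Upsilon(\mu)\,h(f,\ell',u(\nu,\mu))\le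 h(f,\ell,\nu)$; - (C3) if $\ell\in L_c^f\setminus\{\ell_{out}^f\}$ and $(\ell,(g,v),\ell')$ is the only triple in $\to_f$ with source $\ell$: $\epsilon+h(g,\ell_{in}^g,v(\nu))+h(f,\ell',\nu)\le h(f,\ell,\nu)$; - (C4) if $\ell\in L_b^f\setminus\{\ell_{out}^f\}$ and $(\ell,\phi,\ell_1),(\ell,\neg\phi,\ell_2)$ are the two triples in $\to_f$ with source $\ell$: $\mathbf 1_{\nu\models\phi}h(f,\ell_1,\nu)+\mathbf 1_{\nu\models\neg\phi}h(f,\ell_2,\nu)+\epsilon\le h(f,\ell,\nu)$; - (C5) if $\ell\in L_d^f\setminus\{\ell_{out}^f\}$ and $(\ell,\star,\ell_1),(\ell,\star,\ell_2)$ are the two triples in $\to_f$ with source $\ell$: $\max\{h(f,\ell_1,\nu),h(f,\ell_2,\nu)\}+\epsilon\le h(f,\ell,\nu)$. Conventions: $d\cdot\infty=\infty$ for $d\in(0,\infty]$, $0\cdot\infty=0$. **Difference-boundedness.** A ranking measure function $h$ is difference-bounded with constant $\zeta\in(0,\infty)$ if for all stack elements $(f,\ell,\nu)$ with $h(f,\ell,\nu)<\infty$: - (C10) if $\ell\in L_a^f\setminus\{\ell_{out}^f\}$ and $(\ell,u,\ell')$ is the only triple in $\to_f$ with source $\ell$: $|h(f,\ell',u(\nu,\mu))-h(f,\ell,\nu)|\le\zeta$ for all $\mu\in\mathrm{Val}^r$; - (C11) if $\ell\in L_c^f\setminus\{\ell_{out}^f\}$ and $(\ell,(g,v),\ell')$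 is the only triple in $\to_f$ with source $\ell$: $|h(g,\ell_{in}^g,v(\nu))+h(f,\ell',\nu)-h(f,\ell,\nu)|\le\zeta$; - (C12) if $\ell\in L_b^f\setminus\{\ell_{out}^f\}$ and $(\ell,\phi,\ell_1),(\ell,\neg\phi,\ell_2)$ are the two triples in $\to_f$ with source $\ell$: $|\mathbf 1_{\nu\models\phi}h(f,\ell_1,\nu)+\mathbf 1_{\nu\models\neg\phi}h(f,\ell_2,\nu)-h(f,\ell,\nu)|\le\zeta$; - (C13) if $\ell\in L_d^f\setminus\{\ell_{out}^f\}$ and $(\ell,\star,\ell_1),(\ell,\star,\ell_2)$ are the two triples in $\to_f$ with source $\ell$: $\max_{i\in\{1,2\}}|h(f,\ell_i,\nu)-h(f,\ell,\nu)|\le\zeta$. *)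

(* Defs.v *)
From HB Require Import structures.
From mathcomp Require Import all_boot all_order all_algebra.
From mathcomp Require Import all_classical all_reals all_analysis.
From mathcomp Require Import ring lra.

Set Implicit Arguments.
Unset Strict Implicit.
Unset Printing Implicit Defensive.
Import Order.TTheory GRing.Theory Num.Theory.
Local Open Scope classical_set_scope.
Local Open Scope ring_scope.

#[short(type="pointedCountType")]
HB.structure Definition PointedCountable := {T of Countable T & Pointed T}.

(* The product of the discrete sigma-algebras on [nat -> S]. *)
Definition coordinate_sets (S : Type) : set (set (nat -> S)) :=
  [set A | exists i (B : set S), A = [set x | B (x i)]].
Arguments coordinate_sets S : clear implicits.
Notation paths S := (g_sigma_algebraType (coordinate_sets S)).

(* A history-dependent stochastic kernel [K] is realised on ([0, 1[, Lebesgue):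
   each finite history [y 0, ..., y (n-1)] is given the interval [I y n], whose
   length is the probability of the history, and the intervals of its one-step
   extensions partition it. *)
Section path_measure_existence.
Variables (R : realType) (S : pointedCountType) (K : seq S -> S -> R).
Hypothesis K_ge0 : forall h s, 0 <= K h s.
Hypothesis K_sum1 : forall h, \esum_(s in [set: S]) (K h s)%:E = 1%E.

Let s0 : S := point.

Let q h (k : nat) : R := if pickle_inv k is Some s then K h s else 0.
Let c h (k : nat) : R := \sum_(0 <= i < k) q h i.

Let q_ge0 h k : 0 <= q h k.
Proof. by rewrite /q; case: pickle_inv. Qed.

Let qE h s : q h (pickle s) = K h s.
Proof. by rewrite /q pickleK_inv. Qed.

Let cS h k : c h k.+1 = c h k + q h k.
Proof. by rewrite /c big_nat_recr. Qed.

Let pickle_inj : injective (@pickle S).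
Proof. exact: pcan_inj (@pickleK_inv S). Qed.

Let q_sum1 h : (\sum_(k <oo) (q h k)%:E = 1)%E.
Proof.
rewrite nneseries_esumT; last by move=> n; rewrite lee_fin.
rewrite -[RHS](K_sum1 h).
transitivity (\esum_(k in range (@pickle S)) (q h k)%:E).
  rewrite [RHS]esum_mkcond; apply: eq_esum => k _.
  case: ifPn => // kN; rewrite /q; case E: pickle_inv => [s|//].
  have := @pickle_invK S k; rewrite E /= => sk.
  by case/negP: kN; rewrite -sk inE; exists s.
rewrite esum_image; last by move=> x y _ _; exact: pickle_inj.
by apply: eq_esum => s _; rewrite qE.
Qed.

Let c_le1 h k : c h k <= 1.
Proof.
rewrite -lee_fin -(q_sum1 h) /c -sumEFin.
by apply: nneseries_lim_ge => i _ _; rewrite lee_fin.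
Qed.

Let c_ge0 h k : 0 <= c h k.
Proof. exact: sumr_ge0. Qed.

Let c_mono h : {homo c h : i j / (i <= j)%N >-> i <= j}.
Proof.
by apply: homo_leq => [//|? ? ?|i]; [exact: le_trans|rewrite cS lerDl].
Qed.

Let c_gt h v : v < 1 -> exists k, v < c h k.
Proof.
move=> v1; apply: contrapT => /forallNP vc.
suff : (1 <= v%:E)%E by rewrite lee_fin leNgt v1.
rewrite -(q_sum1 h); apply: lime_le.
  by apply: is_cvg_nneseries => n _ _; rewrite lee_fin.
apply: nearW => k; rewrite sumEFin lee_fin leNgt; apply/negP; exact: vc.
Qed.

Let sel h (a p u : R) (s : S) : bool :=
  a + p * c h (pickle s) <= u < a + p * c h (pickle s).+1.

Let sel_ex h a p u : a <= u < a + p -> exists s, sel h a p u s.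
Proof.
move=> /andP[au up]; have p0 : 0 < p by lra.
have [k vk] : exists k, (u - a) / p < c h k.
  by apply: c_gt; rewrite ltr_pdivrMr //; lra.
have [[|m] vm mmin] := ex_minnP (ex_intro (fun k => (u - a) / p < c h k) k vk).
  move: vm; rewrite /c big_geq // ltr_pdivrMr // mul0r; lra.
have mv : c h m <= (u - a) / p.
  by rewrite leNgt; apply/negP => /mmin; rewrite ltnn.
have : q h m != 0.
  by apply/eqP => q0; move: vm; rewrite cS q0 addr0 ltNge mv.
rewrite /q; case E: pickle_inv => [s|]; last by rewrite eqxx.
have := @pickle_invK S m; rewrite E /= => sm _.
exists s; rewrite /sel sm; move: vm mv.
by rewrite ltr_pdivrMr // ler_pdivlMr // => *; apply/andP; split; lra.
Qed.

Let sel_lt h a p u s t : 0 <= p -> sel h a p u s -> sel h a p u t ->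
  ~ (pickle s < pickle t)%N.
Proof.
move=> p0 /andP[_ us] /andP[ut _] /(c_mono h) /(ler_wpM2l p0) st.
move: us ut st; lra.
Qed.

Let sel_inj h a p u s t : 0 <= p -> sel h a p u s -> sel h a p u t -> s = t.
Proof.
move=> p0 us ut; apply: pickle_inj; case: (ltngtP (pickle s) (pickle t)) => //.
- by move/(sel_lt p0 us ut).
- by move/(sel_lt p0 ut us).
Qed.

Let wd (y : nat -> S) n := \prod_(i < n) K (mkseq y i) (y i).
Let lo y n := \sum_(i < n) wd y i * c (mkseq y i) (pickle (y i)).
Let I y n (u : R) := lo y n <= u < lo y n + wd y n.

Let wd_ge0 y n : 0 <= wd y n.
Proof. exact: prodr_ge0. Qed.

Let wdS y n : wd y n.+1 = wd y n * K (mkseq y n) (y n).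
Proof. by rewrite /wd big_ord_recr. Qed.

Let loS y n : lo y n.+1 = lo y n + wd y n * c (mkseq y n) (pickle (y n)).
Proof. by rewrite /lo big_ord_recr. Qed.

Let IS y n u : I y n.+1 u = sel (mkseq y n) (lo y n) (wd y n) u (y n).
Proof. by rewrite /I /sel wdS loS cS qE -addrA -mulrDr. Qed.

Let I_sub y n u : I y n.+1 u -> I y n u.
Proof.
rewrite IS => /andP[h1 h2]; apply/andP; split.
  by apply: le_trans h1; rewrite lerDl mulr_ge0.
apply: lt_le_trans h2 _; rewrite lerD2l.
by rewrite ler_piMr.
Qed.

Let ext (y z : nat -> S) n : (forall i, (i < n)%N -> y i = z i) -> mkseq y n = mkseq z n.
Proof.
by move=> yz; apply/eq_in_map => i; rewrite mem_iota add0n => /yz.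
Qed.

Let wd_ext y z n : (forall i, (i < n)%N -> y i = z i) -> wd y n = wd z n.
Proof.
move=> yz; apply: eq_bigr => i _; rewrite yz // (@ext y z i) // => j ji.
by apply/yz/(ltn_trans ji).
Qed.

Let lo_ext y z n : (forall i, (i < n)%N -> y i = z i) -> lo y n = lo z n.
Proof.
move=> yz; apply: eq_bigr => i _.
have yzi j : (j < i)%N -> y j = z j by move=> ji; apply/yz/(ltn_trans ji).
by rewrite yz // (ext yzi) (wd_ext yzi).
Qed.

Let choice_of (h : seq S) a p u : S := xget s0 [set s | sel h a p u s].

Let st (u : R) : nat -> seq S * R * R := fix st n :=
  if n is m.+1 then
    let: (h, a, p) := st m in
    let s := choice_of h a p u in
    (rcons h s, a + p * c h (pickle s), p * K h s)
  else ([::], 0, 1).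

Let X (u : R) (n : nat) : S := let: (h, a, p) := st u n in choice_of h a p u.

Let stE u n : st u n = (mkseq (X u) n, lo (X u) n, wd (X u) n).
Proof.
elim: n => [|n IH] /=; first by rewrite /lo /wd !big_ord0.
have Xn : X u n = choice_of (mkseq (X u) n) (lo (X u) n) (wd (X u) n) u.
  by rewrite {1}/X IH.
by rewrite IH -Xn -wdS -loS mkseqS.
Qed.

Let XE u n : X u n = choice_of (mkseq (X u) n) (lo (X u) n) (wd (X u) n) u.
Proof. by rewrite {1}/X stE. Qed.

Let XI u n : 0 <= u < 1 -> I (X u) n u.
Proof.
move=> u01; elim: n => [|n IH]; first by rewrite /I /lo /wd !big_ord0 add0r.
rewrite IS XE; have [s ss] := sel_ex (mkseq (X u) n) IH.
exact: (@xgetPex _ s0 [set s | sel _ _ _ u s] (ex_intro _ s ss)).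
Qed.

Let IX u y n : 0 <= u < 1 -> I y n u -> forall i, (i < n)%N -> X u i = y i.
Proof.
move=> u01; elim: n => [//|n IH] Iy.
have {}IH := IH (I_sub Iy).
move=> i; rewrite ltnS leq_eqVlt => /predU1P[->|]; last exact: IH.
have := XI n.+1 u01; rewrite IS (ext IH) (lo_ext IH) (wd_ext IH) => h1.
by move: Iy; rewrite IS => h2; exact: sel_inj h1 h2.
Qed.

Let XP u y n : 0 <= u < 1 ->
  I y n u <-> (forall i, (i < n)%N -> X u i = y i).
Proof.
move=> u01; split; first exact: IX.
by move=> E; have := XI n u01; rewrite /I (lo_ext E) (wd_ext E).
Qed.

Let I01 u y n : I y n u -> 0 <= u < 1.
Proof.
by elim: n => [|n IH /I_sub/IH//]; rewrite /I /lo /wd !big_ord0 add0r.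
Qed.

Let D := [set u : R | 0 <= u < 1].
Let DE : D = `[0, 1[%classic.
Proof. by apply/seteqP; split => u /=; rewrite in_itv. Qed.

Let mD : measurable (D : set (measurableTypeR R)).
Proof. by rewrite DE; exact: measurable_itv. Qed.

Let IE y n : [set u | I y n u] = `[lo y n, lo y n + wd y n[%classic.
Proof. by apply/seteqP; split => u /=; rewrite in_itv. Qed.

Let mI y n : measurable ([set u | I y n u] : set (measurableTypeR R)).
Proof. by rewrite IE; exact: measurable_itv. Qed.

Let Y (u : measurableTypeR R) : nat -> S :=
  if 0 <= u < 1 then X u else fun=> s0.

Let mY (A : set (nat -> S)) : coordinate_sets S A ->
  measurable (Y @^-1` A : set (measurableTypeR R)).
Proof.
move=> [i [B ->]].
have -> : Y @^-1` [set x | B (x i)] =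
   \bigcup_(h : seq S) (if `[< B (nth s0 h i) >]
       then [set u | I (nth s0 h) i.+1 u] else set0)
   `|` (if `[< B s0 >] then ~` D else set0).
  apply/seteqP; split => u /=; rewrite /Y.
    case: ifPn => u01 Bu.
      left; exists (mkseq (X u) i.+1) => //.
      have E j : (j < i.+1)%N -> X u j = nth s0 (mkseq (X u) i.+1) j.
        by move=> ji; rewrite nth_mkseq.
      rewrite -E //; case: asboolP => //= _.
      by apply/XP.
    by right; rewrite (asboolT Bu) /D /=; apply/negP.
  case=> [[h _]|].
    case: asboolP => //= Bh Ih; have u01 := I01 Ih; rewrite u01.
    by rewrite (IX u01 Ih).
  by case: asboolP => //= B0; rewrite /D /= => /negP/negbTE ->.
apply: measurableU.
  apply: countable_bigcupT_measurable => //.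
  by move=> h; case: ifPn => // _; exact: mI.
by case: ifPn => // _; apply: measurableC.
Qed.

Let Ym : measurableTypeR R -> paths S := Y.

Let mYm : measurable_fun [set: measurableTypeR R] Ym.
Proof.
apply: (@measurability _ _ (measurableTypeR R) (paths S) setT Ym
  (coordinate_sets S)) => //.
by move=> _ [A cA <-]; rewrite setTI; exact: mY.
Qed.

Let mu : {measure set (measurableTypeR R) -> \bar R} :=
  mrestr (@lebesgue_measure R) mD.

Let Pm : {measure set (paths S) -> \bar R} :=
  measure_function_pushforward__canonical__measure_function_Measure mu mYm.

Let P : set (paths S) -> \bar R := pushforward mu Ym.
HB.instance Definition _ := isMeasure.Build _ _ _ P (measure0 Pm)
  (@measure_ge0 _ _ _ Pm) (@measure_semi_sigma_additive _ _ _ Pm).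

Let P_setT : P [set: paths S] = 1%E.
Proof.
have -> : P [set: paths S] = lebesgue_measure D.
  by rewrite /P /= /pushforward /= /mrestr preimage_setT setTI.
by rewrite DE lebesgue_measure_itv /= lte01 sube0.
Qed.
HB.instance Definition _ := Measure_isProbability.Build _ _ R P P_setT.

Lemma path_measure_exists : exists P : probability (paths S) R,
  forall y n, P [set x | forall i, (i < n)%N -> x i = y i] =
    (\prod_(i < n) K (mkseq y i) (y i))%:E.
Proof.
exists P => y n.
transitivity (lebesgue_measure [set u | I y n u]).
  rewrite /P /= /pushforward /= /mrestr; congr lebesgue_measure.
  apply/seteqP; split => u /=; rewrite /Ym /Y.
    by case=> + u01; rewrite u01 => E; apply/XP.
  by move=> Iu; have u01 := I01 Iu; rewrite u01; split => //; exact: IX.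
rewrite IE lebesgue_measure_itv /= lte_fin ltrDl; case: ifPn => wd0.
  by rewrite -EFinB addrAC subrr add0r.
by congr EFin; apply/eqP; rewrite eq_le -/(wd y n) wd_ge0 leNgt wd0.
Qed.

End path_measure_existence.

Notation valuation V := {ffun V -> int}.

(* Which arithmetic expressions are available is left open: an expression is
   identified with the integer-valued function of the valuation it denotes. *)
Inductive bpred (V : finType) : Type :=
| BLe of (valuation V -> int) & (valuation V -> int)
| BLt of (valuation V -> int) & (valuation V -> int)
| BEq of (valuation V -> int) & (valuation V -> int)
| BNot of bpred V
| BAnd of bpred V & bpred V
| BOr of bpred V & bpred V.

Fixpoint bsat (V : finType) (nu : valuation V) (phi : bpred V) : bool :=
  match phi with
  | BLe e1 e2 => e1 nu <= e2 nu
  | BLt e1 e2 => e1 nu < e2 nu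
  | BEq e1 e2 => e1 nu == e2 nu
  | BNot p => ~~ bsat nu p
  | BAnd p q => bsat nu p && bsat nu q
  | BOr p q => bsat nu p || bsat nu q
  end.

(* The triples leaving one label of the function [f]: the constructor is the
   kind of the label (so the kinds partition the labels) and its arguments are
   the decoration and the targets.  [Branch phi l1 l2] stands for the two
   triples decorated by [phi] and [BNot phi]; in [Nondet l1 l2], [l1] is the
   then-branch and [l2] the else-branch. *)
Inductive instr (fn svar : finType) (pvar label : fn -> finType) (f : fn) :=
| Assign of (valuation (pvar f) -> valuation svar -> valuation (pvar f))
          & label f
| Call (g : fn) of (valuation (pvar f) -> valuation (pvar g)) & label f
| Branch of bpred (pvar f) & label f & label f
| Nondet of label f & label f.

Arguments Assign {fn svar pvar label f}.
Arguments Call {fn svar pvar label f g}.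
Arguments Branch {fn svar pvar label f}.
Arguments Nondet {fn svar pvar label f}.

Record program := Program {
  fn : finType;
  svar : finType;
  pvar : fn -> finType;
  label : fn -> finType;
  l_in : forall f, label f;
  l_out : forall f, label f;
  l_in_out : forall f, l_in f != l_out f;
  (* the value of [code] at [l_out f] is never used *)
  code : forall f, label f -> instr svar pvar label f }.

Arguments l_in {p} f.
Arguments l_out {p} f.
Arguments code {p f} l.

(* A stack element [(f, l, nu)] is the dependent pair of [f] and [(l, nu)]. *)
Notation elem W := {f : fn W & (label f * valuation (pvar f))%type}.

Definition mk (W : program) (f : fn W) (l : label f)
    (nu : valuation (pvar f)) : elem W :=
  Tagged (fun f => (label f * valuation (pvar f))%type) (l, nu).

Definition terminal (W : program) (d : elem W) : bool :=
  (tagged d).1 == l_out (tag d).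

Notation ntelem W := {d : elem W | ~~ terminal d}.

(* The head of the list is the top of the stack. *)
Notation config W := (seq (ntelem W)).

Definition letter (W : program) (d : elem W) : config W :=
  if insub d is Some d' then [:: d'] else [::].

Definition state (W : program) : Type := (config W * valuation (svar W))%type.

Definition zero_val (V : finType) : valuation V := [ffun => 0].

HB.instance Definition _ (W : program) := Countable.on (state W).
HB.instance Definition _ (W : program) :=
  isPointed.Build (state W) ([::], zero_val (svar W)).


Record discrete_dist (R : realType) (T : choiceType) := DiscreteDist {
  dist_prob :> T -> R;
  dist_ge0 : forall t, 0 <= dist_prob t;
  dist_sum1 : \esum_(t in [set: T]) (dist_prob t)%:E = 1%E }.

Notation sampling R W := (svar W -> discrete_dist R int).

Definition joint_prob (R : realType) (V : finType) (Ups : V -> discrete_dist R int)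
  (mu : valuation V) : R := \prod_r Ups r (mu r).

Definition joint_supp (R : realType) (V : finType) (Ups : V -> discrete_dist R int) :
  set (valuation V) := [set mu | 0 < joint_prob Ups mu].

Lemma joint_ge0 (R : realType) (V : finType) (Ups : V -> discrete_dist R int) mu :
  0 <= joint_prob Ups mu.
Proof. by apply: prodr_ge0 => r _; exact: dist_ge0. Qed.

Lemma esumZl (R : realType) (T : choiceType) (D : set T) (k : R)
    (a : T -> \bar R) : 0 <= k -> (forall t, 0 <= a t)%E ->
  (\esum_(t in D) (k%:E * a t) = k%:E * \esum_(t in D) a t)%E.
Proof.
move=> k0 a0; rewrite /esum -ereal_supZl //; last first.
  by apply/set0P; exists (\sum_(x \in set0) a x)%E, set0; [exact: fsets_set0|].
congr ereal_sup; apply/seteqP; split => x /=.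
  move=> [A [fA AD] <-]; exists (\sum_(t \in A) a t)%E; first by exists A.
  by rewrite ge0_mule_fsumr.
move=> [_ [A [fA AD] <-] <-]; exists A => //.
by rewrite ge0_mule_fsumr.
Qed.

Lemma joint_sum1 (R : realType) (V : finType) (Ups : V -> discrete_dist R int) :
  \esum_(mu in [set: valuation V]) (joint_prob Ups mu)%:E = 1%E.
Proof.
pose A (s : seq V) := [set mu : valuation V | forall r, r \notin s -> mu r = 0].
suff sum1 s : uniq s ->
    \esum_(mu in A s) (\prod_(r <- s) Ups r (mu r))%:E = 1%E.
  rewrite -[RHS](sum1 (enum V) (enum_uniq _)).
  have -> : A (enum V) = setT.
    by apply/seteqP; split => // mu _ r; rewrite mem_enum.
  by apply: eq_esum => mu _; rewrite /joint_prob big_enum.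
elim: s => [_|r s IH /= /andP[rs us]].
  have -> : A [::] = [set zero_val V].
    apply/seteqP; split => mu /=; last by move=> -> r _; rewrite ffunE.
    by move=> m0; apply/ffunP => r; rewrite m0 ?ffunE.
  by rewrite esum_set1 big_nil ?lee01.
pose e (p : int * valuation V) : valuation V :=
  [ffun r' => if r' == r then p.1 else p.2 r'].
rewrite (@reindex_esum R _ _ ([set: int] `*` A s) (A (r :: s)) e) //=; last first.
  split.
  - move=> [z mu] /= [_ mus] r'; rewrite inE negb_or ffunE => /andP[/negbTE ->].
    exact: mus.
  - move=> [z mu] [z' mu'] /[!inE] /= -[_ mus] [_ mus'] /ffunP E.
    have := E r; rewrite !ffunE eqxx /= => ->; congr pair.
    apply/ffunP => r'; have := E r'; rewrite !ffunE /=.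
    by case: eqP => // -> _; rewrite mus // mus'.
  - move=> mu mus; exists (mu r, [ffun r' => if r' == r then 0 else mu r']).
      split=> //= r' r's; rewrite ffunE; case: eqP => // /eqP r'r.
      by apply: mus; rewrite inE negb_or r'r.
    by apply/ffunP => r'; rewrite !ffunE /=; case: eqP => [->|].
transitivity (\esum_(z in [set: int]) \esum_(mu in A s)
    ((Ups r z)%:E * (\prod_(r' <- s) Ups r' (mu r'))%:E)%E).
  rewrite (@esum_esum R _ _ [set: int] (fun=> A s)); last first.
    move=> z mu _ _; rewrite -EFinM lee_fin mulr_ge0 ?dist_ge0 // prodr_ge0 //.
    by move=> *; exact: dist_ge0.
  apply: eq_esum => -[z mu] _ /=; rewrite big_cons -EFinM ffunE eqxx.
  congr ((_ * _)%:E); apply: eq_big_seq => r' r's; rewrite ffunE.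
  by case: eqP => // E; move: rs; rewrite -E r's.
rewrite -[RHS](dist_sum1 (Ups r)); apply: eq_esum => z _.
rewrite esumZl ?dist_ge0 //; last first.
  by move=> mu; rewrite lee_fin prodr_ge0 // => *; exact: dist_ge0.
by rewrite IH // mule1.
Qed.

Variant action := tau | th | el.

Definition action_code (a : action) : option bool :=
  match a with tau => None | th => Some true | el => Some false end.
Definition action_decode (o : option bool) : action :=
  match o with None => tau | Some true => th | Some false => el end.
Lemma action_codeK : cancel action_code action_decode.
Proof. by case. Qed.
HB.instance Definition _ := Finite.copy action (can_type action_codeK).

Section semantics.
Variables (R : realType) (W : program) (Ups : sampling R W).

Definition nondet_top (w : config W) : bool :=
  if w is d :: _ then
    if code (tagged (val d)).1 is Nondet _ _ then true else false
  else false.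

Definition enabled (w : config W) (a : action) : bool :=
  if nondet_top w then a != tau else a == tau.

Definition entry (g : fn W) (nu : valuation (pvar g)) : ntelem W :=
  Sub (mk (l_in g) nu) (l_in_out g).

(* The configuration following [w] when [mu] is sampled; only the enabled
   actions [a] are relevant. *)
Definition next_config (w : config W) (a : action) (mu : valuation (svar W)) :
    config W :=
  if w is d :: w' then
    let: existT f (l, nu) := val d in
    match code l with
    | Assign u l' => letter (mk l' (u nu mu)) ++ w'
    | @Call _ _ _ _ _ g v l' => entry (v nu) :: letter (mk l' nu) ++ w'
    | Branch phi l1 l2 => letter (mk (if bsat nu phi then l1 else l2) nu) ++ w'
    | Nondet l1 l2 => letter (mk (if a == th then l1 else l2) nu) ++ w'
    end
  else [::].

Definition trans (s : state W) (a : action) (s' : state W) : R :=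
  joint_prob Ups s'.2 * (s'.1 == next_config s.1 a s'.2)%:R.

Definition may_step (s s' : state W) : bool :=
  [exists a, enabled s.1 a && (0 < trans s a s')].

Definition is_history (H : seq (state W)) : bool :=
  if H is s :: H' then path.path may_step s H' else false.

Definition history : Type := {H : seq (state W) | is_history H}.

Definition last_state (H : history) : state W := last point (val H).

Record scheduler := Scheduler {
  sched :> history -> action -> R;
  sched_ge0 : forall H a, 0 <= sched H a;
  sched_sum1 : forall H, \sum_a sched H a = 1;
  sched_enabled : forall H a, ~~ enabled (last_state H).1 a -> sched H a = 0 }.

Definition step_prob (sigma : scheduler) (H : history) (s : state W) : R :=
  \sum_a sigma H a * trans (last_state H) a s.

Definition init_state (c : ntelem W) : state W := ([:: c], zero_val (svar W)).

(* The probability that the first [n.+1] states are [y 0], ..., [y n].  A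
   prefix that is not a history is already weighted 0 by an earlier factor. *)
Definition cylinder_prob (sigma : scheduler) (c : ntelem W)
    (y : nat -> state W) (n : nat) : R :=
  (y 0%N == init_state c)%:R *
  \prod_(i < n) (if insub (mkseq y i.+1) is Some H
                 then step_prob sigma H (y i.+1) else 0).

Lemma trans_ge0 s a s' : 0 <= trans s a s'.
Proof. by rewrite mulr_ge0 ?joint_ge0. Qed.

Lemma trans_sum1 s a : \esum_(s' in [set: state W]) (trans s a s')%:E = 1%E.
Proof.
pose e mu : state W := (next_config s.1 a mu, mu).
rewrite -[RHS](joint_sum1 Ups).
transitivity (\esum_(s' in range e) (trans s a s')%:E).
  rewrite [RHS]esum_mkcond; apply: eq_esum => -[w mu] _.
  case: ifPn => // sN; rewrite /trans /=; case: eqP => [wE|_]; last by rewrite mulr0.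
  by case/negP: sN; rewrite inE; exists mu; rewrite // /e -wE.
rewrite esum_image; last by move=> x y _ _ [].
by apply: eq_esum => mu _; rewrite /trans /= eqxx mulr1.
Qed.

Lemma step_prob_ge0 sigma H s : 0 <= step_prob sigma H s.
Proof. by apply: sumr_ge0 => a _; rewrite mulr_ge0 ?sched_ge0 ?trans_ge0. Qed.

Lemma step_prob_sum1 sigma H :
  \esum_(s in [set: state W]) (step_prob sigma H s)%:E = 1%E.
Proof.
under eq_esum do rewrite /step_prob -sumEFin.
rewrite esum_sum; last first.
  by move=> s a _ _; rewrite lee_fin mulr_ge0 ?sched_ge0 ?trans_ge0.
rewrite -[1%E]/((1 : R)%:E) -(sched_sum1 sigma H) -sumEFin.
apply: eq_bigr => a _; under eq_esum do rewrite EFinM.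
rewrite esumZl ?sched_ge0 //; last by move=> s; rewrite lee_fin trans_ge0.
by rewrite trans_sum1 mule1.
Qed.

Lemma path_measure_ex sigma c : exists P : probability (paths (state W)) R,
  forall y n, P [set x | forall i, (i <= n)%N -> x i = y i] =
    (cylinder_prob sigma c y n)%:E.
Proof.
pose K (H : seq (state W)) s : R :=
  if insub H is Some H' then step_prob sigma H' s else (s == init_state c)%:R.
have K0 H s : 0 <= K H s.
  by rewrite /K; case: insub => [H'|//]; exact: step_prob_ge0.
have K1 H : \esum_(s in [set: state W]) (K H s)%:E = 1%E.
  rewrite /K; case: insub => [H'|]; first exact: step_prob_sum1.
  rewrite -[RHS](@esum_set1 R (state W) (init_state c) (fun=> 1%E)) //.
  rewrite [RHS]esum_mkcond; apply: eq_esum => s _.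
  rewrite (_ : (s \in [set init_state c]) = (s == init_state c)); last first.
    by apply/idP/eqP; rewrite inE.
  by case: eqP.
have [P PE] := path_measure_exists K0 K1.
exists P => y n; rewrite (PE y n.+1); congr (_%:E).
suff [] : \prod_(i < n.+1) K (mkseq y i) (y i) = cylinder_prob sigma c y n /\
  (cylinder_prob sigma c y n != 0 -> is_history (mkseq y n.+1)) by [].
elim: n => [|n [IH1 IH2]].
  split=> //; rewrite /cylinder_prob big_ord_recl !big_ord0 !mulr1.
  by rewrite /K insubN.
have cS : cylinder_prob sigma c y n.+1 = cylinder_prob sigma c y n *
    (if insub (mkseq y n.+1) is Some H then step_prob sigma H (y n.+1) else 0).
  by rewrite /cylinder_prob big_ord_recr mulrA.
have bR : \prod_(i < n.+2) K (mkseq y i) (y i) =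
    \prod_(i < n.+1) K (mkseq y i) (y i) * K (mkseq y n.+1) (y n.+1).
  by rewrite big_ord_recr.
rewrite bR cS IH1.
have [c0|/IH2 Hn] := eqVneq (cylinder_prob sigma c y n) 0.
  by rewrite c0 !mul0r eqxx.
rewrite /K insubT; split=> //.
rewrite mulf_eq0 negb_or => /andP[_ /eqP st0].
have ma : may_step (last point (mkseq y n.+1)) (y n.+1).
  apply: contrapT => N; apply: st0; apply: big1 => a _.
  have [ea|/sched_enabled->] := boolP (enabled (last_state (Sub _ Hn)).1 a);
    last by rewrite mul0r.
  have := trans_ge0 (last_state (Sub _ Hn)) a (y n.+1).
  rewrite le_eqVlt => /predU1P[<-|t0]; first by rewrite mulr0.
  by case: N; apply/existsP; exists a; rewrite ea t0.
move: {st0} Hn ma; rewrite (mkseqS y n.+1).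
case: (mkseq y n.+1) => [//|s t] /= Hn ma.
by rewrite rcons_path Hn.
Qed.

Definition path_measure (sigma : scheduler) (c : ntelem W) :
    probability (paths (state W)) R := projT1 (cid (path_measure_ex sigma c)).

(* This determines the measure, as the sets [setT], [set0] and these cylinders
   form a generating pi-system. *)
Lemma path_measureE sigma c y n :
  path_measure sigma c [set x | forall i, (i <= n)%N -> x i = y i] =
    (cylinder_prob sigma c y n)%:E.
Proof. exact: projT2 (cid (path_measure_ex sigma c)) y n. Qed.

(* The infimum is a minimum, and [+oo] on the empty set. *)
Definition term_time (x : nat -> state W) : \bar R :=
  ereal_inf [set n%:R%:E | n in [set n | (x n).1 = [::]]].

Local Open Scope ereal_scope.

(* As [0 * +oo = 0] in [\bar R], the branch not taken contributes 0 in
   [rank_C4] and [diff_C12]. *)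
Record ranking_measure (h : elem W -> \bar R) (eps : R) : Prop := {
  rank_eps : (0 < eps)%R;
  rank_ge0 : forall d, 0 <= h d;
  rank_C1 : forall (f : fn W) nu, h (mk (l_out f) nu) = 0;
  rank_C2 : forall (f : fn W) l nu u l', l != l_out f -> code l = Assign u l' ->
    eps%:E + \esum_(mu in joint_supp Ups) ((joint_prob Ups mu)%:E * h (mk l' (u nu mu)))
      <= h (mk l nu);
  rank_C3 : forall (f g : fn W) l nu (v : valuation (pvar f) -> valuation (pvar g)) l',
    l != l_out f -> code l = Call v l' ->
    eps%:E + h (mk (l_in g) (v nu)) + h (mk l' nu) <= h (mk l nu);
  rank_C4 : forall (f : fn W) l nu phi l1 l2, l != l_out f -> code l = Branch phi l1 l2 ->
    (bsat nu phi)%:R%:E * h (mk l1 nu) + (bsat nu (BNot phi))%:R%:E * h (mk l2 nu)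
      + eps%:E <= h (mk l nu);
  rank_C5 : forall (f : fn W) l nu l1 l2, l != l_out f -> code l = Nondet l1 l2 ->
    maxe (h (mk l1 nu)) (h (mk l2 nu)) + eps%:E <= h (mk l nu) }.

Record difference_bounded (h : elem W -> \bar R) (zeta : R) : Prop := {
  diff_zeta : (0 < zeta)%R;
  diff_C10 : forall (f : fn W) l nu u l', h (mk l nu) < +oo ->
    l != l_out f -> code l = Assign u l' ->
    forall mu, joint_supp Ups mu ->
    `|h (mk l' (u nu mu)) - h (mk l nu)| <= zeta%:E;
  diff_C11 : forall (f g : fn W) l nu (v : valuation (pvar f) -> valuation (pvar g)) l',
    h (mk l nu) < +oo -> l != l_out f -> code l = Call v l' ->
    `|h (mk (l_in g) (v nu)) + h (mk l' nu) - h (mk l nu)| <= zeta%:E;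
  diff_C12 : forall (f : fn W) l nu phi l1 l2, h (mk l nu) < +oo ->
    l != l_out f -> code l = Branch phi l1 l2 ->
    `|(bsat nu phi)%:R%:E * h (mk l1 nu)
      + (bsat nu (BNot phi))%:R%:E * h (mk l2 nu) - h (mk l nu)| <= zeta%:E;
  diff_C13 : forall (f : fn W) l nu l1 l2, h (mk l nu) < +oo ->
    l != l_out f -> code l = Nondet l1 l2 ->
    maxe `|h (mk l1 nu) - h (mk l nu)| `|h (mk l2 nu) - h (mk l nu)|
      <= zeta%:E }.

End semantics.

Arguments term_time R {W} x.

(* Main.v *)
Require Import Defs.
From HB Require Import structures.
From mathcomp Require Import all_boot all_order all_algebra.
From mathcomp Require Import all_classical all_reals all_analysis.
From mathcomp Require Import ring lra.
Set Implicit Arguments.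
Unset Strict Implicit.
Unset Printing Implicit Defensive.
Import Order.TTheory GRing.Theory Num.Theory numFieldNormedType.Exports.
Local Open Scope classical_set_scope.
Local Open Scope ring_scope.

(* Extend [h] additively to configurations and call [V] the result.  Before
   termination each step decreases [V] by at least [eps] in expectation and
   changes it by at most [zeta], so the increments of [V + eps * n] have mean at
   most 0 and absolute value at most [eps + zeta].  Bounding [exp] by its chord
   and [cosh a] by [exp (a^2 / 2)] gives, for [t > 0],
     E exp(t (V' - V + eps)) <= exp(t^2 (eps + zeta)^2 / 2)
   whatever the scheduler does.  Iterating over the [n] steps and using [V >= 0]
   bounds the survival probability by
     exp(t (h c - eps n) + n t^2 (eps + zeta)^2 / 2),
   and [t = (eps n - h c) / (n (eps + zeta)^2)] is optimal.  The iteration is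
   an induction on the number of remaining steps that splits a cylinder
   according to the next state, so no conditional expectations are needed. *)

(** * Bounds on the exponential function and the one-step moment estimate *)

Lemma le0_is_derive_le {R : realType} (f df : R -> R) :
  (forall x : R, is_derive x 1 f (df x)) -> (forall x : R, 0 < x -> df x <= 0) ->
  forall x : R, 0 <= x -> f x <= f 0.
Proof.
move=> fdf df0 x x0.
have cf : {within `[0, x], continuous f}.
  by apply: derivable_within_continuous => y _; apply: ex_derive.
have d (y : R) : y \in `]0, x[%R -> derivable f y 1 by move=> _; apply: ex_derive.
have d0 (y : R) : y \in `]0, x[%R -> derive1 f y <= 0.
  rewrite in_itv /= => /andP[y0 _]; rewrite derive1E.
  by rewrite (@derive_val _ _ _ _ _ _ _ (fdf y)) df0.
by apply: (ler0_derive1_le_cc d d0 cf) => //; rewrite in_itv /= ?lexx ?x0.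
Qed.

(** The ratio [u] of [2 cosh y] to [exp (y^2 / 2)] equals 2 at 0, and its derivative has the sign of
    [v y = 2 (sinh y - y cosh y)]. In turn [v] vanishes at 0 and has derivative [- 2 y sinh y], so
    it is nonpositive. *)
Lemma cosh_le_expR_sqr {R : realType} (x : R) : 0 <= x ->
  expR x + expR (- x) <= 2 * expR (x ^+ 2 / 2).
Proof.
pose v (y : R) := (1 - y) * expR y - (1 + y) * expR (- y).
have v_le0 (y : R) : 0 <= y -> v y <= 0.
  have v0 : v 0 = 0 by rewrite /v oppr0 addr0 !mul1r subrr.
  move=> y0; rewrite -[leRHS]v0; move: y y0.
  apply: (@le0_is_derive_le _ v (fun z => - z * (expR z - expR (- z)))) => z.
    rewrite /v; apply: is_derive_eq; rewrite /GRing.scale /=; ring.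
  by move=> z0; rewrite mulNr oppr_le0 mulr_ge0 ?(ltW z0)// subr_ge0 ler_expR; lra.
pose u (y : R) := (expR y + expR (- y)) * expR (- (y ^+ 2 / 2)).
have u_le : forall y : R, 0 <= y -> u y <= u 0.
  apply: (@le0_is_derive_le _ u (fun y => v y * expR (- (y ^+ 2 / 2)))) => z.
    rewrite /u /v; apply: is_derive_eq; rewrite /GRing.scale /=.
    by field.
  by move=> /ltW z0; rewrite mulr_le0_ge0 ?expR_ge0 ?v_le0.
move=> /u_le; rewrite /u expr0n /= mul0r oppr0 expR0 mulr1.
by rewrite [expR (- (_ / _))]expRN ler_pdivrMr ?expR_gt0 // -[1 + 1]/(2%:R).
Qed.

(* The chord of [exp] over [[-a, a]], whose slope is [sinh a / a]. *)
Lemma expR_le_chord {R : realType} (a y : R) : 0 < a -> `|y| <= a ->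
  expR y <= (expR a + expR (- a)) / 2 + (expR a - expR (- a)) / (2 * a) * y.
Proof.
move=> a0; rewrite ler_norml => /andP[ay ya].
have p0 : 0 <= (a + y) / (2 * a) by rewrite divr_ge0; lra.
have p1 : (a + y) / (2 * a) <= 1 by rewrite ler_pdivrMr; lra.
pose p : {i01 R} := Itv01 p0 p1.
have := convex_expR p a (- a); rewrite !convRE /= /unstable.onem.
have -> : (a + y) / (2 * a) * a + (1 - (a + y) / (2 * a)) * - a = y.
  by field; lra.
by move=> /le_trans; apply; rewrite le_eqVlt; apply/orP; left; apply/eqP; field; lra.
Qed.

(** Here [x] plays the current potential and [X i] the next one. The mean hypothesis makes the
    linear term of the chord bound nonpositive on average. [X i] can be infinite only where
    [p i = 0], so [fine] loses nothing. *)
Lemma hoeffding_esum {R : realType} {T : choiceType} (p : T -> R)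
    (X : T -> \bar R) (x eps zeta t : R) :
  (forall i, 0 <= p i) -> (\esum_(i in [set: T]) (p i)%:E = 1)%E ->
  (forall i, 0 <= X i)%E -> 0 < eps -> 0 < zeta -> 0 < t ->
  (forall i, 0 < p i -> (`|X i - x%:E| <= zeta%:E)%E) ->
  (eps%:E + \esum_(i in [set: T]) ((p i)%:E * X i) <= x%:E)%E ->
  (\esum_(i in [set: T]) ((p i)%:E * (expR (t * fine (X i)))%:E)
    <= (expR (t * (x - eps) + t ^+ 2 * (eps + zeta) ^+ 2 / 2))%:E)%E.
Proof.
move=> p0 p1 X0 eps0 zeta0 t0 Xx mean.
pose a := t * (eps + zeta); have a0 : 0 < a by rewrite mulr_gt0 ?addr_gt0.
(* Scaled by [K], the chord bound at [t * (r - x + eps)] reads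
   [expR (t * r) <= k + b * (r - x + eps)]. *)
pose K := expR (t * (x - eps)).
pose b := K * ((expR a - expR (- a)) / (2 * a) * t).
pose k := K * ((expR a + expR (- a)) / 2).
have b0 : 0 <= b.
  rewrite !mulr_ge0 ?expR_ge0 ?invr_ge0 ?mulr_ge0 ?(ltW t0) ?(ltW a0) //.
  - by rewrite subr_ge0 ler_expR; lra.
  - by lra.
have k0 : 0 <= k by rewrite !mulr_ge0 ?addr_ge0 ?expR_ge0.
have m0 : (0 <= \esum_(i in [set: T]) ((p i)%:E * X i))%E.
  by apply: esum_ge0 => i _; rewrite mule_ge0 ?lee_fin.
have x0 : 0 <= x.
  rewrite -lee_fin; apply: le_trans mean; rewrite adde_ge0 // lee_fin; exact: ltW.
have cst r : 0 <= r -> (\esum_(i in [set: T]) ((p i)%:E * r%:E) = r%:E)%E.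
  move=> r0; under eq_esum do rewrite muleC.
  by rewrite esumZl ?p1 ?mule1 // => i; rewrite lee_fin.
(* The term [b * x] stands on the left so that all summands are nonnegative and the sums can be
   split in [\bar R]. *)
have chord i : ((p i)%:E * (expR (t * fine (X i)))%:E + (p i)%:E * (b * x)%:E
    <= (p i)%:E * (k + b * eps)%:E + b%:E * ((p i)%:E * X i))%E.
  have := p0 i; rewrite le_eqVlt => /predU1P[<-|pi0].
    by rewrite !mul0e mule0 adde0.
  have := Xx i pi0; move: (X0 i); case: (X i) => [r|//|//] _ /=.
  rewrite lee_fin ler_norml => /andP[r1 r2].
  rewrite -!EFinM -!EFinD lee_fin [b * (_ * r)]mulrCA -!mulrDr ler_pM2l //.
  have ya : `|t * (r - x + eps)| <= a.
    by rewrite ler_norml /a -mulrN !ler_pM2l //; apply/andP; split; lra.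
  have := ler_wpM2l (expR_ge0 (t * (x - eps))) (expR_le_chord a0 ya).
  rewrite -expRD -/K.
  have -> : t * (x - eps) + t * (r - x + eps) = t * r by ring.
  move=> chord_r; suff -> : k + b * eps + b * r =
      K * ((expR a + expR (- a)) / 2 +
        (expR a - expR (- a)) / (2 * a) * (t * (r - x + eps))) + b * x.
    by rewrite lerD2r.
  by rewrite /k /b; field; rewrite gt_eqF.
have /= := le_esum (fun i (_ : [set: T] i) => chord i).
have bx0 : 0 <= b * x by rewrite mulr_ge0.
have kb0 : 0 <= k + b * eps by apply: addr_ge0 => //; rewrite mulr_ge0 // ltW.
rewrite !esumD; try by move=> *; rewrite ?mule_ge0 ?lee_fin ?expR_ge0.
rewrite esumZl // => [|i]; last by rewrite mule_ge0 ?lee_fin.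
rewrite !cst // => S.
apply: (@le_trans _ _ k%:E); last first.
  rewrite lee_fin expRD -/K ler_pM2l ?expR_gt0 // ler_pdivrMr // mulrC.
  by rewrite -exprMn -/a cosh_le_expR_sqr // ltW.
(* With the finite [b * x] added on both sides, what remains is [b] times the mean hypothesis. *)
rewrite -(leeD2rE (x := (b * x)%:E)) //; apply: le_trans S _.
rewrite EFinD -addeA leeD2l // !EFinM -muleDr ?lee_wpmul2l ?lee_fin //.
Qed.

(** * The additive extension of [h] to configurations and its drift *)

Definition potential {R : realType} {W : program} (h : elem W -> \bar R)
  (w : config W) : \bar R := (\sum_(d <- w) h (val d))%E.

Lemma potential_cat {R : realType} {W : program} (h : elem W -> \bar R) w1 w2 :
  potential h (w1 ++ w2) = (potential h w1 + potential h w2)%E.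
Proof. exact: big_cat. Qed.

Lemma potential_cons {R : realType} {W : program} (h : elem W -> \bar R)
    d w : potential h (d :: w) = (h (val d) + potential h w)%E.
Proof. exact: big_cons. Qed.

(** A step acts on the top letter only, which reduces drift estimates to one-letter
    configurations. *)
Lemma next_config_cat {W : program} (d : ntelem W) w a mu :
  next_config (d :: w) a mu = next_config [:: d] a mu ++ w.
Proof.
rewrite /next_config; case: (val d) => f [l nu].
by case: (Defs.code l) => [u l'|g v l'|phi l1 l2|l1 l2] /=; rewrite cats0.
Qed.

Lemma esum_joint_cst {R : realType} {V : finType} (Ups : V -> discrete_dist R int)
    (x : \bar R) : (0 <= x)%E -> x \is a fin_num ->
  (\esum_(mu in [set: valuation V]) ((joint_prob Ups mu)%:E * x))%E = x.
Proof.
move=> x0 xfin; rewrite -[in RHS](mule1 x) -(joint_sum1 Ups) -[x]fineK //.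
rewrite -esumZl ?fine_ge0 // => [|mu]; last by rewrite lee_fin joint_ge0.
by apply: eq_esum => mu _; rewrite muleC.
Qed.

Section drift.
Variables (R : realType) (W : program) (Ups : sampling R W).
Variables (h : elem W -> \bar R) (eps zeta : R).
Hypothesis hr : ranking_measure Ups h eps.
Hypothesis hd : difference_bounded Ups h zeta.

Lemma potential_ge0 w : (0 <= potential h w)%E.
Proof. by apply: sume_ge0 => d _; exact: rank_ge0 hr _. Qed.

(** Terminal elements are erased from the stack, and (C1) gives them value 0. *)
Lemma potential_letter d : potential h (letter d) = h d.
Proof.
rewrite /potential /letter; case: insubP => [d' _ <-|]; first by rewrite big_seq1.
case: d => f [l nu]; rewrite negbK /terminal /= => /eqP ->.
by rewrite big_nil -(rank_C1 hr nu).
Qed.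

(** One of (C10) to (C13) for each kind of label. The action is arbitrary, since (C13) bounds both
    branches. *)
Lemma head_diff (d : ntelem W) a mu : (h (val d) < +oo)%E ->
  joint_supp Ups mu ->
  (`|potential h (next_config [:: d] a mu) - h (val d)| <= zeta%:E)%E.
Proof.
case: d => [[f [l nu]] /= lo] hfin mus.
case E: (Defs.code l) => [u l'|g v l'|phi l1 l2|l1 l2]; rewrite cats0.
- by rewrite potential_letter; exact: (diff_C10 hd hfin lo E mus).
- rewrite potential_cons potential_letter.
  exact: (diff_C11 hd hfin lo E).
- rewrite potential_letter.
  have := diff_C12 hd hfin lo E; rewrite /=.
  by case: bsat => /=; rewrite mul0e mul1e ?adde0 ?add0e.
- rewrite potential_letter.
  have := diff_C13 hd hfin lo E; rewrite ge_max => /andP[? ?].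
  by case: ifP.
Qed.

Lemma head_mean (d : ntelem W) a : (h (val d) < +oo)%E ->
  (eps%:E + \esum_(mu in [set: valuation (svar W)])
     ((joint_prob Ups mu)%:E * potential h (next_config [:: d] a mu))
   <= h (val d))%E.
Proof.
case: d => [[f [l nu]] /= lo] hfin.
(* Only an assignment reads the sample; for the other kinds of label the successor is constant in
   [mu]. *)
have cst x : (0 <= x -> x + eps%:E <= h (mk l nu) ->
    eps%:E + \esum_(mu in [set: valuation (svar W)]) ((joint_prob Ups mu)%:E * x)
      <= h (mk l nu))%E.
  move=> x0 xh; rewrite esum_joint_cst // 1?addeC //.
  rewrite ge0_fin_numE // (le_lt_trans _ hfin) // (le_trans _ xh) //.
  by rewrite leeDl // lee_fin ltW // (rank_eps hr).
case E: (Defs.code l) => [u l'|g v l'|phi l1 l2|l1 l2].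
(* (C2) sums over the support only; elsewhere the weight is 0, and [0 * +oo = 0]. *)
- apply: le_trans (rank_C2 hr nu lo E); rewrite leeD2l //.
  rewrite [leRHS]esum_mkcond; apply: le_esum => mu _.
  rewrite cats0 potential_letter; case: ifPn => // /negP.
  rewrite inE /joint_supp /= => /negP; rewrite -leNgt => mu0.
  have -> : joint_prob Ups mu = 0 by apply/eqP; rewrite eq_le mu0 joint_ge0.
  by rewrite mul0e.
- under eq_esum do rewrite cats0 potential_cons potential_letter.
  apply: cst; first by rewrite adde_ge0 // (rank_ge0 hr).
  by rewrite addeC addeA; exact: (rank_C3 hr nu lo E).
- under eq_esum do rewrite cats0 potential_letter.
  apply: cst; first exact: rank_ge0 hr _.
  have := rank_C4 hr nu lo E; rewrite /=.
  by case: bsat => /=; rewrite mul0e mul1e ?adde0 ?add0e.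
- under eq_esum do rewrite cats0 potential_letter.
  apply: cst; first exact: rank_ge0 hr _.
  apply: le_trans (rank_C5 hr nu lo E); rewrite leeD2r // le_max.
  by case: ifP => _; rewrite lexx ?orbT.
Qed.

Lemma potential_consoo d w : (potential h (d :: w) < +oo)%E ->
  (h (val d) < +oo)%E /\ (potential h w < +oo)%E.
Proof.
rewrite potential_cons => dw; split; apply: le_lt_trans dw.
  by rewrite leeDl // potential_ge0.
by rewrite leeDr // (rank_ge0 hr).
Qed.

Lemma potential_diff w a mu : w != [::] -> (potential h w < +oo)%E ->
  joint_supp Ups mu ->
  (`|potential h (next_config w a mu) - potential h w| <= zeta%:E)%E.
Proof.
case: w => // d w _ /potential_consoo[dfin wfin] mus.
rewrite next_config_cat potential_cat potential_cons.
apply: le_trans (head_diff a dfin mus).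
move: dfin wfin; rewrite -!ge0_fin_numE ?potential_ge0 ?(rank_ge0 hr) //.
move=> dfin wfin; rewrite fin_num_oppeD //.
(* The rest of the stack has finite potential, so it cancels. *)
by rewrite addeACA subee // adde0.
Qed.

Lemma potential_mean w a : w != [::] -> (potential h w < +oo)%E ->
  (eps%:E + \esum_(mu in [set: valuation (svar W)])
     ((joint_prob Ups mu)%:E * potential h (next_config w a mu))
   <= potential h w)%E.
Proof.
case: w => // d w _ /potential_consoo[dfin wfin].
under eq_esum => mu _.
  rewrite next_config_cat potential_cat ge0_muleDr ?potential_ge0 //; over.
rewrite esumD; try by move=> *; rewrite mule_ge0 ?potential_ge0 // lee_fin joint_ge0.
rewrite esum_joint_cst ?potential_ge0 // ?ge0_fin_numE ?potential_ge0 //.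
by rewrite addeA potential_cons leeD2r // head_mean.
Qed.

End drift.

(** * Sums over successor states, cylinders and measurability *)

(** For a fixed action the sample determines the successor, and the successor records the sample;
    the map [e] is therefore injective and its range carries all the mass. *)
Lemma esum_trans {R : realType} {W : program} (Ups : sampling R W) s a
    (phi : state W -> \bar R) : (forall s', 0 <= phi s')%E ->
  (\esum_(s' in [set: state W]) ((trans Ups s a s')%:E * phi s') =
   \esum_(mu in [set: valuation (svar W)])
     ((joint_prob Ups mu)%:E * phi (next_config s.1 a mu, mu)))%E.
Proof.
move=> phi0; pose e mu : state W := (next_config s.1 a mu, mu).
transitivity (\esum_(s' in range e) ((trans Ups s a s')%:E * phi s')%E).
  rewrite [RHS]esum_mkcond; apply: eq_esum => -[w mu] _.
  case: ifPn => // sN; rewrite /trans /=.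
  case: eqP => [wE|_]; last by rewrite mulr0 mul0e.
  by case/negP: sN; rewrite inE; exists mu; rewrite // /e -wE.
rewrite esum_image; last by move=> x y _ _ [].
by apply: eq_esum => mu _; rewrite /trans /= eqxx mulr1.
Qed.

Lemma esum_step_prob {R : realType} {W : program} {Ups : sampling R W}
    (sigma : scheduler Ups) H (phi : state W -> \bar R) :
  (forall s, 0 <= phi s)%E ->
  (\esum_(s in [set: state W]) ((step_prob sigma H s)%:E * phi s) =
   \sum_a (sigma H a)%:E *
     \esum_(s in [set: state W]) ((trans Ups (last_state H) a s)%:E * phi s))%E.
Proof.
move=> phi0.
have pos a s : (0 <= (trans Ups (last_state H) a s)%:E * phi s)%E.
  by rewrite mule_ge0 // lee_fin trans_ge0.
under [RHS]eq_bigr do rewrite -esumZl ?sched_ge0 //.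
rewrite -esum_sum; last by move=> s a _ _; rewrite mule_ge0 // lee_fin sched_ge0.
apply: eq_esum => s _; rewrite /step_prob -sumEFin ge0_sume_distrl //.
  by apply: eq_bigr => a _; rewrite EFinM muleA.
by move=> a _; rewrite lee_fin mulr_ge0 ?sched_ge0 ?trans_ge0.
Qed.

(** The union bound over a countable type: sigma-subadditivity along the enumeration [pickle_inv],
    with the empty set at indices that code no element. *)
Lemma measure_le_esum d {R : realType} {T : measurableType d}
    {S : pointedCountType} (m : {measure set T -> \bar R}) (A : set T)
    (F : S -> set T) :
  measurable A -> (forall s, measurable (F s)) -> A `<=` \bigcup_s F s ->
  (m A <= \esum_(s in [set: S]) m (F s))%E.
Proof.
move=> mA mF AF; pose G k := if pickle_inv k is Some s then F s else set0.
have mG k : measurable (G k) by rewrite /G; case: pickle_inv.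
have AG : A `<=` \bigcup_k G k.
  by move=> x /AF[s _ Fsx]; exists (pickle s); rewrite // /G pickleK_inv.
apply: le_trans (measure_sigma_subadditive m mG mA AG) _.
rewrite nneseries_esumT //.
apply: (@le_trans _ _ (\esum_(k in range (@pickle S)) m (G k))%E).
  rewrite [leRHS]esum_mkcond; apply: le_esum => k _; case: ifPn => // kN.
  rewrite /G; case E: pickle_inv => [s|]; last by rewrite measure0.
  have := @pickle_invK S k; rewrite E /= => sk.
  by case/negP: kN; rewrite -sk inE; exists s.
rewrite esum_image; last first.
  by move=> s s' _ _; exact: (pcan_inj (@pickleK_inv S)).
by apply: le_esum => s _; rewrite /G pickleK_inv.
Qed.

(** Prefixes are represented by infinite sequences, so prolonging one by [s] must again give a
    sequence. *)
Definition extend {W : program} (y : nat -> state W) m s : nat -> state W :=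
  fun i => if (i <= m)%N then y i else s.

(** The chain rule, which takes the place of conditioning on the first [m.+1] states. *)
Lemma cylinder_prob_extend {R : realType} {W : program} {Ups : sampling R W}
    (sigma : scheduler Ups) c y m s :
  cylinder_prob sigma c (extend y m s) m.+1 = cylinder_prob sigma c y m *
    (if insub (mkseq y m.+1) is Some H then step_prob sigma H s else 0).
Proof.
have E j : (j <= m.+1)%N -> mkseq (extend y m s) j = mkseq y j.
  move=> jm; apply/eq_in_map => i; rewrite mem_iota add0n /extend => /= ij.
  by rewrite -ltnS (leq_trans ij jm).
rewrite /cylinder_prob big_ord_recr /= mulrA E //.
rewrite /extend ltnn leq0n; congr (_ * _ * _).
apply: eq_bigr => i _.
rewrite -/(extend y m s) E; last by rewrite ltnS ltnW // ltn_ord.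
by rewrite ltn_ord.
Qed.

Lemma cylinder_prob_ge0 {R : realType} {W : program} {Ups : sampling R W}
    (sigma : scheduler Ups) c y m : 0 <= cylinder_prob sigma c y m.
Proof. by rewrite -lee_fin -path_measureE. Qed.

Lemma measurable_coordinate {S : pointedType} i (B : set S) :
  measurable ([set x | B (x i)] : set (paths S)).
Proof. by apply: sub_sigma_algebra; exists i, B. Qed.

Lemma measurable_finite_coordinates {S : pointedType} m n (B : nat -> set S) :
  measurable ([set x | forall i, (m <= i <= n)%N -> B i (x i)] : set (paths S)).
Proof.
rewrite (_ : [set x | _] = \bigcap_i
    [set x : paths S | ((m <= i <= n)%N -> B i (x i))]).
  apply: bigcap_measurable => // i _.
  exact: (measurable_coordinate i [set s | ((m <= i <= n)%N -> B i s)]).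
by apply/seteqP; split => x /= xB i; [move=> _; exact: xB|exact: xB].
Qed.

Lemma lt_term_time {R : realType} {W : program} n (x : nat -> state W) :
  (n%:R%:E < term_time R x)%E <-> forall i, (i <= n)%N -> (x i).1 != [::].
Proof.
split=> [nT i lei|xN].
  apply/eqP => xi; move: nT; rewrite ltNge => /negP; apply.
  apply: (@le_trans _ _ i%:R%:E); last by rewrite lee_fin ler_nat.
  by apply: ereal_inf_lbound; exists i.
(* Going through [n.+1] keeps the inequality strict after taking the infimum, also when it is
   [+oo]. *)
apply: (@lt_le_trans _ _ n.+1%:R%:E); first by rewrite lte_fin ltr_nat.
apply: le_ereal_inf_tmp => _ [i /= xi <-]; rewrite lee_fin ler_nat ltnNge.
by apply/negP => /xN; rewrite xi.
Qed.

(** * Iteration of the one-step estimate along cylinders *)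

Section tail.
Variables (R : realType) (W : program) (Ups : sampling R W).
Variables (h : elem W -> \bar R) (eps zeta t : R).
Hypothesis hr : ranking_measure Ups h eps.
Hypothesis hd : difference_bounded Ups h zeta.
Hypothesis t0 : 0 < t.

Let V w : R := fine (potential h w).

(** A step of positive probability uses a sample in the support, so the bounded difference carries
    finiteness over to the successor. *)
Lemma step_prob_potential (sigma : scheduler Ups) H s :
  (last_state H).1 != [::] -> (potential h (last_state H).1 < +oo)%E ->
  step_prob sigma H s != 0 -> (potential h s.1 < +oo)%E.
Proof.
move=> w0 wfin st0; apply: contrapT => soo; case/eqP: st0; apply: big1 => a _.
have [wE|wN] := eqVneq s.1 (next_config (last_state H).1 a s.2); last first.
  by rewrite /trans (negbTE wN) mulr0 mulr0.
have := joint_ge0 Ups s.2; rewrite le_eqVlt => /predU1P[j0|j0].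
  by rewrite /trans -j0 mul0r mulr0.
have := potential_diff hr hd a w0 wfin j0; rewrite -wE => d.
case: soo; move: d wfin; have := potential_ge0 hr s.1.
have := potential_ge0 hr (last_state H).1.
case: (potential h s.1) => [r|//|//]; first by rewrite ltry.
by case: (potential h (last_state H).1).
Qed.

Lemma esum_step_expR (sigma : scheduler Ups) H :
  (last_state H).1 != [::] -> (potential h (last_state H).1 < +oo)%E ->
  (\esum_(s in [set: state W]) ((step_prob sigma H s)%:E * (expR (t * V s.1))%:E)
   <= (expR (t * (V (last_state H).1 - eps)
             + t ^+ 2 * (eps + zeta) ^+ 2 / 2))%:E)%E.
Proof.
move=> w0 wfin; rewrite esum_step_prob => [|s]; last by rewrite lee_fin expR_ge0.
set B := (X in (_ <= X)%E).
(* The bound is the same for every action, so it survives averaging with the weights of the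
   scheduler. *)
have -> : B = (\sum_a (sigma H a)%:E * B)%E.
  rewrite -ge0_sume_distrl => [|a _]; last by rewrite lee_fin sched_ge0.
  by rewrite sumEFin sched_sum1 mul1e.
apply: lee_sum => a _; rewrite lee_wpmul2l ?lee_fin ?sched_ge0 //.
rewrite esum_trans => [|s]; last by rewrite lee_fin expR_ge0.
have VE : (V (last_state H).1)%:E = potential h (last_state H).1.
  by rewrite fineK // ge0_fin_numE // (potential_ge0 hr).
apply: hoeffding_esum => //.
- exact: joint_ge0.
- exact: joint_sum1.
- by move=> mu; exact: (potential_ge0 hr).
- exact: rank_eps hr.
- exact: diff_zeta hd.
- by move=> mu mu0; rewrite VE; exact: (potential_diff hr hd).
- by rewrite VE; exact: (potential_mean hr).
Qed.

(** Quantifying over [y] and [m] lets the induction on [k] pass from a prefix to its one-state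
    extensions. *)
Lemma survival_bound (sigma : scheduler Ups) c k : forall y m,
  (potential h (y m).1 < +oo)%E ->
  (path_measure sigma c [set x | (forall i, (i <= m)%N -> x i = y i) /\
       forall i, (m <= i <= m + k)%N -> (x i).1 != [::]]
   <= (cylinder_prob sigma c y m * expR (t * V (y m).1 +
         (t ^+ 2 * (eps + zeta) ^+ 2 / 2 - t * eps) *+ k))%:E)%E.
Proof.
have mcyl y m : measurable ([set x | forall i, (i <= m)%N -> x i = y i]
    : set (paths (state W))).
  exact: (measurable_finite_coordinates 0 m (fun i => [set y i])).
have mE y m l : measurable ([set x | (forall i, (i <= m)%N -> x i = y i) /\
       forall i, (m <= i <= m + l)%N -> (x i).1 != [::]]
    : set (paths (state W))).
  apply: measurableI; first exact: mcyl.
  exact: (measurable_finite_coordinates m (m + l)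
    (fun=> [set s : state W | s.1 != [::]])).
have le_cyl y m l : (path_measure sigma c [set x | (forall i, (i <= m)%N ->
    x i = y i) /\ forall i, (m <= i <= m + l)%N -> (x i).1 != [::]]
    <= (cylinder_prob sigma c y m)%:E)%E.
  by rewrite -path_measureE; apply: le_measure; rewrite ?inE // => x [].
elim: k => [|k IH] y m yfin.
  rewrite mulr0n addr0; apply: le_trans (le_cyl _ _ _) _.
  (* As the potential is nonnegative, the exponential factor is at least 1. *)
  rewrite lee_fin ler_peMr ?cylinder_prob_ge0 // -[leLHS]expR0 ler_expR.
  rewrite mulr_ge0 ?(ltW t0) //.
  by rewrite fine_ge0 // (potential_ge0 hr).
(* The window includes time [m], so an empty configuration there makes the event empty. *)
have [y0|y0] := eqVneq (y m).1 [::].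
  rewrite (_ : [set x | _] = set0); last first.
    apply/seteqP; split => // x [xy /(_ m)].
    by rewrite leqnn leq_addr xy // y0 => /(_ isT).
  by rewrite measure0 lee_fin mulr_ge0 ?cylinder_prob_ge0 ?expR_ge0.
apply: le_trans (measure_le_esum (path_measure sigma c)
  (F := fun s => [set x | (forall i, (i <= m.+1)%N -> x i = extend y m s i) /\
     forall i, (m.+1 <= i <= m.+1 + k)%N -> (x i).1 != [::]]) _ _ _) _ => //.
  move=> x [xy xN]; exists (x m.+1) => //; split=> i; last first.
    by case/andP=> mi ik; apply: xN; rewrite (ltnW mi) addnS.
  rewrite /extend; case: (leqP i m) => [im _|mi im]; first exact: xy.
  by congr x; apply/eqP; rewrite eqn_leq im.
pose e := t ^+ 2 * (eps + zeta) ^+ 2 / 2 - t * eps.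
pose C := cylinder_prob sigma c y m.
have C0 : 0 <= C by exact: cylinder_prob_ge0.
have Ce0 : 0 <= C * expR (e *+ k) by apply: mulr_ge0; rewrite ?expR_ge0.
have cE s := cylinder_prob_extend sigma c y m s.
(* If the prefix is not a history, each of its extensions has probability 0. *)
case: insubP cE => [H _ HE|_] cE; last first.
  apply: (@le_trans _ _ 0%E); last first.
    by rewrite lee_fin; apply: mulr_ge0; rewrite ?expR_ge0.
  rewrite -(esum1 (D := [set: state W]) (a := fun=> 0%E)) //.
  by apply: le_esum => s _; rewrite (le_trans (le_cyl _ _ _)) // cE mulr0.
have lH : last_state H = y m by rewrite /last_state HE mkseqS last_rcons.
apply: (@le_trans _ _ (\esum_(s in [set: state W])
   ((C * expR (e *+ k))%:E * ((step_prob sigma H s)%:E * (expR (t * V s.1))%:E)))%E).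
  apply: le_esum => s _.
  (* The induction hypothesis needs a finite potential, which is known only for successors of
     positive probability; the others contribute 0. *)
  have [st0|st0] := eqVneq (step_prob sigma H s) 0.
    by rewrite st0 mul0e mule0 (le_trans (le_cyl _ _ _)) // cE st0 mulr0.
  have ext : extend y m s m.+1 = s by rewrite /extend ltnn.
  apply: le_trans (IH _ _ _) _; rewrite ext.
    by apply: step_prob_potential st0; rewrite lH.
  rewrite -!EFinM lee_fin cE -/C -/e expRD le_eqVlt; apply/orP; left.
  by apply/eqP; ring.
rewrite esumZl // => [|s]; last first.
  by rewrite mule_ge0 // lee_fin ?step_prob_ge0 ?expR_ge0.
apply: le_trans (lee_wpmul2l _ (esum_step_expR _ _ _)) _; rewrite ?lH //.
rewrite -EFinM lee_fin -[C * _ * _]mulrA -expRD -/C -/e ler_wpM2l // ler_expR.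
by rewrite [_ *+ k.+1]mulrS -/e /e; lra.
Qed.
End tail.

(** * Specialisation to the initial state and the optimal exponent *)

Theorem theorem10 (R : realType) (W : program) (Ups : sampling R W)
    (h : elem W -> \bar R) (eps zeta : R)
    (h_ranking : ranking_measure Ups h eps)
    (h_diff : difference_bounded Ups h zeta)
    (n : nat) (c : ntelem W)
    (h_fin : (h (val c) < +oo)%E)
    (n_gt : fine (h (val c)) / eps < n%:R) :
  (ereal_sup [set path_measure sigma c [set x | n%:R%:E < term_time R x]
               | sigma in [set: scheduler Ups]]
   <= (expR (- ((eps * n%:R - fine (h (val c))) ^+ 2
                / (2 * n%:R * (eps + zeta) ^+ 2))))%:E)%E.
Proof.
have eps0 := rank_eps h_ranking; have zeta0 := diff_zeta h_diff.
have hc0 : 0 <= fine (h (val c)) by rewrite fine_ge0 // (rank_ge0 h_ranking).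
(* Positivity of [n] makes the denominator of [t] nonzero. *)
have n0 : 0 < n%:R :> R by apply: le_lt_trans n_gt; rewrite divr_ge0 // ltW.
set hc := fine _ in hc0 n_gt *.
have gap0 : 0 < eps * n%:R - hc.
  by move: n_gt; rewrite ltr_pdivrMr // mulrC subr_gt0.
have ez0 : 0 < eps + zeta by rewrite addr_gt0.
pose t := (eps * n%:R - hc) / (n%:R * (eps + zeta) ^+ 2).
have t0 : 0 < t by rewrite divr_gt0 // mulr_gt0 // exprn_gt0.
have potc : potential h [:: c] = h (val c) by rewrite /potential big_seq1.
apply: ge_ereal_sup => _ [sigma _ <-].
pose y (_ : nat) := init_state c.
have yfin : (potential h (y 0%N).1 < +oo)%E by rewrite potc.
have P0 : path_measure sigma c [set x | forall i, (i <= 0)%N -> x i = y i] = 1%E.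
  by rewrite path_measureE /cylinder_prob big_ord0 eqxx mulr1.
have mC : measurable ([set x | forall i, (i <= 0)%N -> x i = y i]
    : set (paths (state W))).
  exact: (measurable_finite_coordinates 0 0 (fun i => [set y i])).
have PC := probability_setC (path_measure sigma c) mC; rewrite P0 subee // in PC.
have mN : measurable ([set x | forall i, (0 <= i <= n)%N -> (x i).1 != [::]]
    : set (paths (state W))).
  exact: (measurable_finite_coordinates 0 n
    (fun=> [set s : state W | s.1 != [::]])).
have -> : [set x | n%:R%:E < term_time R x]%E =
    [set x : paths (state W) | forall i, (0 <= i <= n)%N -> (x i).1 != [::]].
  apply/seteqP; split => x.
    by move=> /lt_term_time xN i; exact: xN.
  by move=> xN; apply/lt_term_time => i; exact: xN.
(* Paths not starting in [init_state c] form a null set by [PC], so the survival event may be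
   intersected with the cylinder of length one. *)
rewrite (@le_trans _ _ (path_measure sigma c
  [set x | (forall i, (i <= 0)%N -> x i = y i) /\
    forall i, (0 <= i <= 0 + n)%N -> (x i).1 != [::]])) //.
  rewrite -(setIT [set x | _]) -(setUv [set x : paths (state W) |
    forall i, (i <= 0)%N -> x i = y i]) setIUr measureU0.
  - by rewrite setIC.
  - exact: measurableI.
  - by apply: measurableI => //; exact: measurableC.
  - apply: (subset_measure0 _ (measurableC mC) (@subIsetr _ _ _)) PC.
    by apply: measurableI => //; exact: measurableC.
apply: le_trans (survival_bound h_ranking h_diff t0 sigma c n
  (y := y) (m := 0) yfin) _.
have -> : cylinder_prob sigma c y 0 = 1.
  by rewrite /cylinder_prob big_ord0 eqxx mulr1.
rewrite mul1r lee_fin ler_expR potc -/hc -mulr_natr le_eqVlt; apply/orP; left.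
by apply/eqP; rewrite /t; field; rewrite !gt_eqF.
Qed.
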